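(* For a rational number $x=\frac pq\in[0,1]$, the following properties are equivalent. (1) The local level set $L_x^{loc}$ has positive Hausdorff dimension. (2) The local level set $L_x^{loc}$ is uncountable. (3) The binary expansion of $x$ can be written as $0.a_1\cdots a_s(b_1\cdots b_r)^\infty$ with $s\ge0$, $r\ge1$, where the periodic part $b_1\cdots b_r$ has an equal number of zeros and ones, and the preperiodic part $a_1\cdots a_s$ also has an equal number of zeros and ones. Moreover, if these equivalent properties hold, then $\dim_H(L_x^{loc})=\frac kr$, where $r$ is the number of bits in the periodic part of the binary expansion of $x$ and $k$ is the number of balance points per period (i.e. the number of balance points $c\in Z(x)$ with $s<c\le s+r$).
   Context: Here $x$ is taken to specify a binary expansion $x=0.b_1b_2b_3\ldots=\sum_{j\ge1} b_j2^{-j}$ with $b_j\in\{0,1\}$ (a dyadic rational in $(0,1)$ has two expansions, treated as distinct elements). Metric statements refer to the set of real numbers represented; $\dim_H$ is Hausdorff dimension. The notation $(b_1\cdots b_r)^\infty$ means the string repeated forever. For a binary expansion $x=0.b_1b_2\ldots$ put $D_0(x)=0$ and $D_j(x)=j-2(b_1+\cdots+b_j)$ for $j\ge1$. The balance-set is $Z(x)=\{j\ge 0: D_j(x)=0\}=\{c_0<c_1<c_2<\cdots\}$ with $c_0=0$; its elements are called balance points; if $Z(x)$ is finite with last element $c_n$, set $c_{n+1}=+\infty$. The $k$-th block $B_k(x)$ is the indexed string of digits $(b_j)_{c_k<j\le c_{k+1}}$ (all $j>c_k$ if $c_{k+1}=+\infty$). Two expansions are equivalent, $x\sim x'$, if $Z(x)=Z(x')$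 and for each $k$ the block $B_k(x')$ either equals $B_k(x)$ or is obtained from it by flipping every digit ($b_j\mapsto 1-b_j$ for all $j$ in the block). The local level set of $x$ is $L_x^{loc}=\{x': x'\sim x\}$. *)

(* Defs.v *)
From HB Require Import structures.
From mathcomp Require Import all_boot all_order all_algebra.
From mathcomp Require Import all_classical all_reals all_analysis.

Set Implicit Arguments.
Unset Strict Implicit.
Unset Printing Implicit Defensive.

Import Order.TTheory GRing.Theory Num.Theory.
Import numFieldNormedType.Exports.

Local Open Scope classical_set_scope.
Local Open Scope ring_scope.

(** ** Hausdorff dimension of a subset of the real line *)

(* The element 0 is added so that the empty set has diameter 0 (the library's
   supremum of set0 is -oo). *)
Definition diam (R : realType) (U : set R) : \bar R :=
  ereal_sup ([set 0%E] `|` [set (`|z.1 - z.2|)%:E | z in U `*` U]).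

(* (diam U)^s, with the conventions 0 for U empty and 0^0 = 1 for U a nonempty
   set of diameter 0, so that the measure of exponent 0 is counting measure. *)
Definition diam_pow (R : realType) (s : R) (U : set R) : \bar R :=
  if pselect (U = set0) then 0%E else poweR (diam U) s.

Definition hausdorff_premeasure (R : realType) (s delta : R) (A : set R) :
    \bar R :=
  ereal_inf [set (\sum_(0 <= i <oo) diam_pow s (U i))%E | U in
    [set U : nat -> set R |
       A `<=` \bigcup_i U i /\ forall i, (diam (U i) <= delta%:E)%E]].

Definition hausdorff_measure (R : realType) (s : R) (A : set R) : \bar R :=
  ereal_sup [set hausdorff_premeasure s delta A | delta in
    [set delta : R | 0 < delta]].

Definition hausdorff_dim (R : realType) (A : set R) : \bar R :=
  ereal_inf [set s%:E | s in
    [set s : R | 0 <= s /\ hausdorff_measure s A = 0%E]].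

(** ** Binary expansions *)

(* The expansion 0.b_1 b_2 b_3 ... is the function whose value at i is b_(i+1),
   so the two expansions of a dyadic rational are distinct elements. *)
Definition expansion := nat -> bool.

(* The digit b_j, meaningful for j >= 1. *)
Definition digit (b : expansion) (j : nat) : bool := b j.-1.

Definition expansion_value (R : realType) (b : expansion) : R :=
  limn (fun n => \sum_(1 <= j < n.+1) (digit b j)%:R * 2^-1 ^+ j : R).

Definition deficit (b : expansion) (j : nat) : int :=
  j%:Z - 2 * (\sum_(1 <= i < j.+1) digit b i)%N%:Z.

Definition balance_set (b : expansion) : set nat :=
  [set j | deficit b j = 0].

(* None stands for +oo. *)
Definition next_balance (b : expansion) (c : nat) : option nat :=
  match pselect (exists j, (c < j)%N && (deficit b j == 0)) with
  | left ex_j => Some (ex_minn ex_j)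
  | right _ => None
  end.

(* c_k. When the balance-set is finite with last element c_n, this is None for
   all k > n; only k = n+1 is then read as c_(n+1) = +oo (see [in_block]). *)
Definition balance_point (b : expansion) (k : nat) : option nat :=
  iter k (obind (next_balance b)) (Some 0%N).

(* j is an index of the block B_k; there is no block B_k when c_k does not
   exist. *)
Definition in_block (b : expansion) (k j : nat) : bool :=
  match balance_point b k, balance_point b k.+1 with
  | Some c, Some c' => (c < j <= c')%N
  | Some c, None => (c < j)%N
  | None, _ => false
  end.

Definition expansion_equiv (b b' : expansion) : Prop :=
  balance_set b = balance_set b' /\
  forall k, (forall j, in_block b k j -> digit b' j = digit b j) \/
            (forall j, in_block b k j -> digit b' j = ~~ digit b j).

Definition local_level_set (b : expansion) : set expansion :=
  [set b' | expansion_equiv b b'].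

(* 0.a_1...a_s(w_1...w_r)^oo, for w nonempty. *)
Definition periodic_expansion (a w : seq bool) : expansion :=
  fun i => if (i < size a)%N then nth false a i
           else nth false w ((i - size a) %% size w).

Definition balanced_word (w : seq bool) : Prop :=
  count_mem false w = count_mem true w.

Definition balanced_periodic_form (b : expansion) (a w : seq bool) : Prop :=
  [/\ (0 < size w)%N, b = periodic_expansion a w,
      balanced_word w & balanced_word a].

Definition balance_count (b : expansion) (s r : nat) : nat :=
  count (fun c => deficit b c == 0) (iota s.+1 r).

(* Main.v *)
Require Import Defs.
From HB Require Import structures.
From mathcomp Require Import all_boot all_order all_algebra.
From mathcomp Require Import all_classical all_reals all_analysis.
From mathcomp Require Import zify ring lra.

Import Order.TTheory GRing.Theory Num.Theory.
Import numFieldNormedType.Exports.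

Local Open Scope classical_set_scope.
Local Open Scope ring_scope.

(** Why the theorem holds. Along an expansion the deficit is a walk on the
    integers with steps +1 and -1, the balance points are its zeros, and a
    member of the local level set arises by choosing, independently for each
    block between consecutive zeros, whether to reflect the walk there
    ([local_level_setE]). Finitely many blocks leave finitely many choices, so
    everything turns on how often the walk returns to 0.

    The digits of a rational number are eventually periodic
    ([rational_eventually_periodic]). A walk with periodic steps either has a
    nonzero drift per period, and then returns to 0 finitely often, or has
    drift 0; in the latter case an uncountable level set provides a zero beyond
    the preperiod, and cutting the expansion there gives a balanced preperiod
    and a balanced period ([uncountable_balanced_form]).

    For a balanced form, let r be the length of the period and k the number of
    balance points per period. The first s + m r digits of a member depend on a
    constant plus m k choices, so about 2^(m k) intervals of length about
    2^(- m r) cover the level set and the dimension is at most k / r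
    ([hausdorff_measure_flip_eq0]). Conversely, reading the choices themselves
    as a binary expansion maps the level set onto the unit interval. This map
    is Hoelder continuous of exponent k / r ([flip_blocks_holder]): two members
    that separate at digit i agree on about k i / r choices, and their values
    are really 2^(- i) apart up to a constant, because the zero digits that
    occur in every balanced period exclude the carry 0111... = 1000...
    ([expansion_value_gap]). A Hoelder map cannot spread a set that is too
    small over the unit interval ([hausdorff_measure_holder_neq0]), which gives
    the lower bound k / r. As k is positive, the dimension is positive, while
    a countable set has dimension 0. *)

(** * Values of binary expansions *)

Definition partial_value (R : realType) (b : expansion) (n : nat) : R :=
  \sum_(1 <= j < n.+1) (digit b j)%:R * 2^-1 ^+ j.

Definition shift (b : expansion) (n : nat) : expansion := fun i => b (n + i)%N.

Lemma partial_valueS (R : realType) (b : expansion) (n : nat) :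
  partial_value R b n.+1 =
  2^-1 * ((b 0%N)%:R + partial_value R (shift b 1) n).
Proof.
rewrite /partial_value !big_add1 /= big_nat_recl //= expr1 [_ * 2^-1]mulrC.
rewrite mulrDr; congr (_ + _); rewrite big_distrr /=.
by apply: eq_bigr => i _; rewrite exprS /digit /shift /= add1n; ring.
Qed.

Lemma partial_value_le1 (R : realType) (b : expansion) (n : nat) :
  partial_value R b n <= 1.
Proof.
elim: n b => [|n IH] b; first by rewrite /partial_value big_geq.
rewrite partial_valueS; have := IH (shift b 1).
by case: (b 0%N) => /=; lra.
Qed.

Lemma nondecreasing_partial_value (R : realType) (b : expansion) :
  nondecreasing_seq (partial_value R b).
Proof.
apply/nondecreasing_seqP => n.
rewrite /partial_value [leRHS]big_nat_recr //= lerDl.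
by rewrite mulr_ge0 // ?exprn_ge0 ?invr_ge0.
Qed.

Lemma partial_value_cvg (R : realType) (b : expansion) :
  partial_value R b @ \oo --> expansion_value R b.
Proof.
apply: nondecreasing_is_cvgn; first exact: nondecreasing_partial_value.
by exists 1 => _ [n _ <-]; exact: partial_value_le1.
Qed.

(** Reading off one digit doubles the remaining real number; every estimate on
    values below is an induction along this recursion. *)
Lemma expansion_valueS (R : realType) (b : expansion) :
  expansion_value R b = 2^-1 * ((b 0%N)%:R + expansion_value R (shift b 1)).
Proof.
have := partial_value_cvg R b; rewrite -cvg_shiftS.
move=> /(cvg_lim (@Rhausdorff R)) <-.
apply: (cvg_lim (@Rhausdorff R)).
rewrite (_ : (fun n => _) =
  fun n => 2^-1 * ((b 0%N)%:R + partial_value R (shift b 1) n)); last first.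
  by apply/funext => n; rewrite partial_valueS.
by apply: cvgMr; apply: cvgD; [exact: cvg_cst|exact: partial_value_cvg].
Qed.

Lemma expansion_value_ge0 (R : realType) (b : expansion) :
  0 <= expansion_value R b.
Proof.
apply: (cvgr_to_ge (partial_value_cvg R b)).
by apply: nearW => n; apply: sumr_ge0 => i _; rewrite mulr_ge0 ?exprn_ge0.
Qed.

Lemma expansion_value_le1 (R : realType) (b : expansion) :
  expansion_value R b <= 1.
Proof.
apply: (cvgr_to_le (partial_value_cvg R b)).
by apply: nearW => n; exact: partial_value_le1.
Qed.

Lemma shift_shift1 (b : expansion) (n : nat) :
  shift (shift b 1) n = shift b n.+1.
Proof. by apply/funext => i; rewrite /shift addnA add1n. Qed.

Lemma expansion_value_common_prefix (R : realType) (b b' : expansion) (n : nat) :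
  (forall i, (i < n)%N -> b i = b' i) ->
  expansion_value R b' - expansion_value R b =
  2^-1 ^+ n *
  (expansion_value R (shift b' n) - expansion_value R (shift b n)).
Proof.
elim: n b b' => [|n IH] b b' bb'.
  by rewrite expr0 mul1r.
rewrite [in LHS]expansion_valueS [X in _ - X]expansion_valueS bb' //.
rewrite -!(shift_shift1 _ n) exprS -mulrA -IH; first by ring.
by move=> i lt_in; apply: bb'.
Qed.

Lemma dist_expansion_value_prefix (R : realType) (b b' : expansion) (n : nat) :
  (forall i, (i < n)%N -> b i = b' i) ->
  `|expansion_value R b' - expansion_value R b| <= 2^-1 ^+ n.
Proof.
move=> /(expansion_value_common_prefix R) ->.
rewrite normrM ger0_norm ?exprn_ge0 // ler_piMr ?exprn_ge0 //.
have := expansion_value_ge0 R (shift b n).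
have := expansion_value_le1 R (shift b n).
have := expansion_value_ge0 R (shift b' n).
have := expansion_value_le1 R (shift b' n).
by rewrite ler_norml => ? ? ? ?; apply/andP; split; lra.
Qed.

Lemma expansion_value_zero_digit (R : realType) (b : expansion) (j : nat) :
  b j = false -> expansion_value R b <= 1 - 2^-1 ^+ j.+1.
Proof.
elim: j b => [|j IH] b bj; rewrite expansion_valueS.
  rewrite bj expr1 /=.
  by have := expansion_value_le1 R (shift b 1); lra.
have := IH (shift b 1) bj.
rewrite [2^-1 ^+ j.+2]exprS; set e := 2^-1 ^+ j.+1.
by case: (b 0%N) => /=; lra.
Qed.

(** Two expansions first differing at [i] may still have equal values, but
    only by the carry 0111... = 1000...; a later zero digit of the smaller one
    breaks the carry and separates the values. *)
Lemma expansion_value_gap (R : realType) (b b' : expansion) (i j : nat) :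
  (forall l, (l < i)%N -> b l = b' l) -> b i = false -> b' i = true ->
  (i < j)%N -> b j = false ->
  2^-1 ^+ j.+1 <= expansion_value R b' - expansion_value R b.
Proof.
move=> pre bi b'i lt_ij bj; rewrite (expansion_value_common_prefix R _ _ _ pre).
rewrite [expansion_value R (shift b' i)]expansion_valueS.
rewrite [expansion_value R (shift b i)]expansion_valueS /shift !addn0 bi b'i.
have zj : shift (shift b i) 1 (j - i.+1)%N = false.
  by rewrite /shift -bj; congr b; lia.
have := expansion_value_zero_digit R _ _ zj.
have := expansion_value_ge0 R (shift (shift b' i) 1).
rewrite /shift; set u := expansion_value R _; set v := expansion_value R _.
move=> u0 vle.
rewrite (_ : j.+1 = i + (j - i.+1).+2)%N; last by lia.
rewrite exprD ler_wpM2l ?exprn_ge0 // exprS.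
by move: vle; set e := 2^-1 ^+ (j - i.+1).+1; rewrite /=; lra.
Qed.

(** Greedy expansion: output 1 exactly when the remainder is at least 1/2. *)
Definition greedy_remainder (R : realType) (x : R) (n : nat) : R :=
  iter n (fun y : R => 2 * y - (1 <= 2 * y)%R%:R) x.

Lemma expansion_value_surj (R : realType) (x : R) :
  0 <= x < 1 -> exists b, expansion_value R b = x.
Proof.
move=> x01; pose y := greedy_remainder R x.
have y01 n : 0 <= y n < 1.
  elim: n => [//|n]; rewrite /y /= -/(y n).
  case: (lerP 1 (2 * y n)) => /= h /andP[h0 h1]; apply/andP; split; lra.
pose b : expansion := fun i => 1 <= 2 * y i; exists b.
have close n : `|expansion_value R (shift b n) - y n| <= 1.
  have := y01 n; have := expansion_value_ge0 R (shift b n).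
  have := expansion_value_le1 R (shift b n).
  by rewrite ler_norml => ? ? /andP[? ?]; apply/andP; split; lra.
have rec n : expansion_value R b - x =
    2^-1 ^+ n * (expansion_value R (shift b n) - y n).
  elim: n => [|n ->].
    by rewrite expr0 mul1r.
  rewrite (expansion_valueS R (shift b n)) exprSr.
  rewrite (_ : shift (shift b n) 1 = shift b n.+1); last first.
    by apply/funext => i; rewrite /shift addnA addn1.
  by rewrite /y /= -/(y n) {1}/shift addn0 /b; field.
have e0 : (fun n => 2^-1 ^+ n : R) @ \oo --> (0 : R).
  by apply: cvg_expr; rewrite ger0_norm //; lra.
apply/eqP; rewrite -subr_eq0 -normr_le0; apply/ler_addgt0Pr => e e_gt0.
rewrite add0r; have /cvgrPdist_le/(_ e e_gt0)[N _ /(_ N)] := e0.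
rewrite /= leqnn sub0r normrN => /(_ isT); apply: le_trans.
by rewrite (rec N) normrM ler_piMr.
Qed.

(** * The deficit walk and its blocks *)

Lemma deficit0 (b : expansion) : deficit b 0 = 0.
Proof. by rewrite /deficit big_geq. Qed.

Lemma deficitS (b : expansion) (n : nat) :
  deficit b n.+1 = deficit b n + (1 - 2 * (b n : nat)%:Z).
Proof. by rewrite /deficit big_nat_recr //= /digit /=; lia. Qed.

Lemma deficit_cat (b : expansion) (s n : nat) :
  deficit b (s + n) = deficit b s + deficit (shift b s) n.
Proof.
elim: n => [|n IH]; first by rewrite addn0 deficit0 addr0.
by rewrite addnS !deficitS IH -addrA.
Qed.

Lemma deficit_bound (b : expansion) (n : nat) :
  - n%:Z <= deficit b n <= n%:Z.
Proof.
elim: n => [|n IH]; first by rewrite deficit0.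
by rewrite deficitS; case: (b n); lia.
Qed.

Lemma balanced_word_mkseq (b : expansion) (n : nat) :
  balanced_word (mkseq b n) <-> deficit b n = 0.
Proof.
suff -> : deficit b n =
    (count_mem false (mkseq b n))%:Z - (count_mem true (mkseq b n))%:Z.
  by rewrite /balanced_word; split; lia.
elim: n => [|n IH]; first by rewrite deficit0.
rewrite deficitS IH mkseqS -cats1 !count_cat /=.
by case: (b n) => /=; lia.
Qed.

(** The number of balance points in [1, i]; since the block B_k collects the
    digits after c_k, this is also the index of the block that contains the
    digit [b i]. *)
Definition balance_rank (b : expansion) (i : nat) : nat :=
  count (fun c => deficit b c == 0) (iota 1 i).

Lemma balance_rankD (b : expansion) (s r : nat) :
  balance_rank b (s + r) = (balance_rank b s + balance_count b s r)%N.
Proof. by rewrite /balance_rank iotaD count_cat add1n. Qed.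

Lemma balance_rankS (b : expansion) (i : nat) :
  balance_rank b i.+1 = (balance_rank b i + (deficit b i.+1 == 0%R))%N.
Proof. by rewrite -[i.+1]addn1 balance_rankD /balance_count /= addn0 addn1. Qed.

Lemma leq_balance_rank (b : expansion) (m n : nat) :
  (m <= n)%N -> (balance_rank b m <= balance_rank b n)%N.
Proof. by move=> /subnKC <-; rewrite balance_rankD leq_addr. Qed.

Lemma ltn_balance_rank (b : expansion) (m c : nat) :
  deficit b c = 0 -> (balance_rank b m < balance_rank b c)%N = (m < c)%N.
Proof.
move=> c0; apply/idP/idP; last first.
  case: c c0 => // c c0; rewrite ltnS => /leq_balance_rank le_mc.
  by rewrite balance_rankS c0 eqxx addn1 ltnS le_mc.
by apply: contraTT; rewrite -!leqNgt; apply: leq_balance_rank.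
Qed.

Lemma balance_rank_const (b : expansion) (c d : nat) :
  (c <= d)%N -> (forall j, (c < j <= d)%N -> deficit b j != 0) ->
  balance_rank b d = balance_rank b c.
Proof.
move=> /subnKC <-; elim: (d - c)%N => [|n IH] nz; first by rewrite addn0.
rewrite addnS balance_rankS IH => [|j /andP[? ?]]; last by apply: nz; lia.
by rewrite (negbTE (nz _ _)) ?addn0 //; lia.
Qed.

(** The rank turns the iterated search for the next zero into a closed form:
    c_k is the zero of rank k. *)
Lemma balance_pointP (b : expansion) (k : nat) :
  match balance_point b k with
  | Some c => deficit b c = 0 /\ balance_rank b c = k
  | None => forall c, (balance_rank b c < k)%N
  end.
Proof.
elim: k => [|k]; first by rewrite /balance_point /= deficit0.
rewrite /balance_point /=; case: (iter _ _ _) => [c|] /=; last first.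
  by move=> lt_k c; exact/ltnW/lt_k.
case=> c0 rank_c; rewrite /next_balance; case: pselect => [ex|nex]; last first.
  move=> d; rewrite ltnS -rank_c; case: (leqP d c) => [/leq_balance_rank//|lt].
  rewrite (balance_rank_const _ _ _ (ltnW lt)) // => j /andP[ltj _].
  by apply/negP => j0; apply: nex; exists j; rewrite ltj.
case: ex_minnP => c' /andP[lt_cc' /eqP c'0] min; split=> //.
case: c' => [//|c'] in lt_cc' c'0 min *.
rewrite balance_rankS c'0 eqxx addn1 (balance_rank_const _ c) ?rank_c //.
move=> j /andP[ltj lej]; apply/negP => j0.
by have := min j; rewrite ltj j0 => /(_ isT); lia.
Qed.

Lemma in_blockE (b : expansion) (k j : nat) :
  in_block b k j = (0 < j)%N && (balance_rank b j.-1 == k).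
Proof.
rewrite /in_block; have := balance_pointP b k.
case: (balance_point b k) => [c [c0 rank_c]|lt_k]; last first.
  by rewrite ltn_eqF ?andbF.
have le_c : (c <= j.-1)%N = (k <= balance_rank b j.-1)%N.
  by rewrite -rank_c leqNgt -(ltn_balance_rank _ _ _ c0) -leqNgt.
have := balance_pointP b k.+1.
case: (balance_point b k.+1) => [c' [c'0 rank_c']|lt_k].
  have lt_c' : (j.-1 < c')%N = (balance_rank b j.-1 < k.+1)%N.
    by rewrite -rank_c' ltn_balance_rank.
  by case: j le_c lt_c' => [//|j] /= le_c lt_c'; rewrite ltnS le_c lt_c'; lia.
case: j le_c => [//|j] /= le_c; rewrite ltnS le_c.
by have := lt_k j; lia.
Qed.

(** * Flipping blocks *)

Definition flip_blocks (b : expansion) (e : nat -> bool) : expansion :=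
  fun i => b i (+) e (balance_rank b i).

(** Along a flipped block the walk [deficit] is reflected; reflections match up
    at the ends of the blocks because the walk vanishes there. *)
Lemma deficit_flip_blocks (b : expansion) (e : nat -> bool) (n : nat) :
  deficit (flip_blocks b e) n = (-1) ^+ (e (balance_rank b n)) * deficit b n.
Proof.
elim: n => [|n IH]; first by rewrite !deficit0 mulr0.
rewrite deficitS IH balance_rankS /flip_blocks.
case: eqP => [n0|_].
  rewrite n0; move: n0; rewrite deficitS.
  by case: (e (balance_rank b n)); case: (b n) => /=; rewrite ?expr0 ?expr1; lia.
rewrite addn0 deficitS.
by case: (e (balance_rank b n)); case: (b n) => /=; rewrite ?expr0 ?expr1; lia.
Qed.

(** Whether a block was flipped is recovered by comparing its digits; since
    the reflections fix the zeros of the walk, every choice of flips stays in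
    the level set. *)
Lemma local_level_setE (b : expansion) :
  local_level_set b = range (flip_blocks b).
Proof.
apply/seteqP; split=> [b' [_ blocks]|_ [e _ <-]].
  exists (fun k => ~~ `[< forall j, in_block b k j -> digit b' j = digit b j >]).
    by [].
  apply/funext => i; rewrite /flip_blocks.
  have in_i : in_block b (balance_rank b i) i.+1 by rewrite in_blockE /= eqxx.
  case: asboolP => [same|not_same].
    by have := same _ in_i; rewrite /digit /= addbF.
  have [//|opp] := blocks (balance_rank b i).
  by have := opp _ in_i; rewrite /digit /= addbT.
split.
  apply/seteqP; split=> j /=; rewrite /balance_set /= deficit_flip_blocks.
    by move->; rewrite mulr0.
  by move/eqP; rewrite mulf_eq0 signr_eq0 => /eqP.
move=> k; case ek: (e k); [right|left] => j; rewrite in_blockE => /andP[_ /eqP jk].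
  by rewrite /digit /flip_blocks jk ek addbT.
by rewrite /digit /flip_blocks jk ek addbF.
Qed.

(** With the zeros bounded the rank is bounded, so only a finite prefix of the
    sequence of flips matters. *)
Lemma countable_local_level_set (b : expansion) (M : nat) :
  (forall c, deficit b c = 0 -> (c <= M)%N) -> countable (local_level_set b).
Proof.
move=> zM; have rankM i : (balance_rank b i <= balance_rank b M)%N.
  case: (leqP i M) => [/leq_balance_rank//|lt].
  rewrite (balance_rank_const _ _ _ (ltnW lt)) // => j /andP[ltj _].
  by apply/eqP => /zM; lia.
have sub : local_level_set b `<=` range (fun s => flip_blocks b (nth false s)).
  rewrite local_level_setE => _ [e _ <-].
  exists (mkseq e (balance_rank b M).+1) => //.
  by apply/funext => i; rewrite /flip_blocks nth_mkseq // ltnS.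
apply: (@sub_countable _ _ _ _ (subset_card_le sub)).
exact: (@sub_countable _ _ _ _ (card_image_le _ _)).
Qed.

(** * Periodic steps *)

Definition eventually_periodic (b : expansion) (s r : nat) : Prop :=
  forall i, (s <= i)%N -> b (i + r)%N = b i.

Lemma deficit_period (b : expansion) (s r n m : nat) :
  eventually_periodic b s r -> (s <= n)%N ->
  deficit b (n + m * r) = deficit b n + m%:Z * (deficit b (s + r) - deficit b s).
Proof.
move=> per le_sn.
have one i : (s <= i)%N ->
    deficit b (i + r) = deficit b i + (deficit b (s + r) - deficit b s).
  move=> /subnKC <-; elim: (i - s)%N => [|d IH]; first by rewrite addn0; lia.
  by rewrite addnS addSn !deficitS IH per ?leq_addr //; lia.
elim: m => [|m IH]; first by rewrite mul0n addn0; lia.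
rewrite mulSn addnCA addnC one ?IH; lia.
Qed.

(** A walk with periodic steps either drifts away linearly, and then returns to
    0 only finitely often, or has period with zero drift. *)
Lemma uncountable_drift0 (b : expansion) (s r : nat) :
  (0 < r)%N -> eventually_periodic b s r -> ~ countable (local_level_set b) ->
  deficit b (s + r) = deficit b s.
Proof.
move=> r0 per; apply: contra_notP => /eqP drift.
(* After m periods the drift moves the walk by at least m, and before it the
   walk is below s + r in absolute value, so a zero forces m <= s + r. *)
apply: (countable_local_level_set _ (s + r + (s + r) * r)) => c c0.
case: (leqP c s) => [|lt_sc]; first by lia.
have cE : c = ((s + (c - s) %% r) + ((c - s) %/ r) * r)%N.
  by rewrite -addnA [X in (s + X)%N]addnC -divn_eq subnKC // ltnW.
have lt_r : ((c - s) %% r < r)%N by rewrite ltn_mod.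
move: c0; rewrite {1}cE (deficit_period _ _ _ _ _ per) ?leq_addr // => c0.
have := deficit_bound b (s + (c - s) %% r).
set m := ((c - s) %/ r)%N in c0 cE; set d := deficit b _ in c0.
move=> d_bound; have m_le : (m <= s + r)%N.
  have : `|m%:Z * (deficit b (s + r) - deficit b s)| <= (s + r)%:Z.
    by rewrite ler_norml; lia.
  rewrite normrM; have : 1 <= `|deficit b (s + r) - deficit b s|.
    by rewrite -gtz0_ge1 normr_gt0 subr_eq0.
  by nia.
by rewrite cE; nia.
Qed.

(** The preperiod is extended up to a zero of the walk. *)
Lemma uncountable_balanced_form (b : expansion) (s r : nat) :
  (0 < r)%N -> eventually_periodic b s r -> ~ countable (local_level_set b) ->
  exists a w, balanced_periodic_form b a w.
Proof.
move=> r0 per unc; have drift := uncountable_drift0 _ _ _ r0 per unc.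
have [c [c0 le_sc]] : exists c, deficit b c = 0 /\ (s <= c)%N.
  apply: contrapT => none; apply: unc.
  apply: (countable_local_level_set _ s) => c c0; rewrite leqNgt.
  by apply/negP => /ltnW le_sc; apply: none; exists c.
exists (mkseq b c), (mkseq (shift b c) r); split.
- by rewrite size_mkseq.
- apply/funext => i; rewrite /periodic_expansion !size_mkseq.
  case: ltnP => [lt_ic|le_ci]; first by rewrite nth_mkseq.
  rewrite nth_mkseq ?ltn_mod // /shift -[in LHS](subnKC le_ci).
  rewrite {1}(divn_eq (i - c) r).
  move: (_ %/ _)%N (_ %% _)%N => m d; elim: m => [//|m IH].
  by rewrite -{}IH -(per (c + (m * r + d))%N); [congr b|]; lia.
- apply/balanced_word_mkseq.
  have := deficit_cat b c r; have := deficit_period _ _ _ _ 1 per le_sc.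
  by rewrite mul1n drift c0; lia.
- exact/balanced_word_mkseq.
Qed.

Lemma balanced_form_period (b : expansion) (a w : seq bool) :
  balanced_periodic_form b a w ->
  [/\ eventually_periodic b (size a) (size w), deficit b (size a) = 0
    & deficit b (size a + size w) = 0].
Proof.
case=> w0 bE bal_w bal_a.
have aE : mkseq b (size a) = a.
  rewrite bE; apply: (@eq_from_nth _ false); rewrite size_mkseq // => i lt_ia.
  by rewrite nth_mkseq // /periodic_expansion lt_ia.
have wE : mkseq (shift b (size a)) (size w) = w.
  rewrite bE; apply: (@eq_from_nth _ false); rewrite size_mkseq // => i lt_iw.
  rewrite nth_mkseq // /shift /periodic_expansion ltnNge leq_addr addKn /=.
  by rewrite modn_small.
have a0 : deficit b (size a) = 0 by apply/balanced_word_mkseq; rewrite aE.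
split=> //; last by rewrite deficit_cat a0 add0r; apply/balanced_word_mkseq; rewrite wE.
move=> i le_ai; rewrite bE /periodic_expansion !ltnNge le_ai.
rewrite (leq_trans le_ai (leq_addr _ _)) /= -addnBAC // modnDr //.
Qed.

(** * Expansions of rational numbers *)

Lemma nat_pigeonhole (f : nat -> nat) (K : nat) :
  (forall n, (f n <= K)%N) -> exists m n, (m < n)%N /\ f m = f n.
Proof.
move=> f_le; pose g (i : 'I_K.+2) : 'I_K.+1 := inord (f i).
have /injectivePn[i [j neq_ij gij]] : ~~ injectiveb g.
  by apply/injectiveP => /leq_card; rewrite !card_ord ltnn.
have fij : f i = f j by have := congr1 val gij; rewrite /= !inordK ?ltnS.
move: neq_ij; rewrite neq_ltn => /orP[lt|lt]; last by exists j, i.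
by exists i, j.
Qed.

(** The digit emitted at numerator [t n] over [q] is forced by [t n], except at
    the tie [2 * t n = q]; a tie sends the numerator to one of the fixed points
    0 and [q], so it occurs at most once. After that the numerators follow an
    autonomous recursion in the finite set {0, ..., q}. *)
Lemma doubling_orbit_eventually_periodic (b : expansion) (q : int)
    (t : nat -> int) :
  0 < q -> (forall n, 0 <= t n <= q) ->
  (forall n, t n.+1 = 2 * t n - q * (b n : nat)%:Z) ->
  exists s r, (0 < r)%N /\ eventually_periodic b s r.
Proof.
move=> q_gt0 t_bound tS.
have [N no_tie] : exists N, forall n, (N <= n)%N -> 2 * t n != q.
  case: (pselect (exists n, 2 * t n = q)) => [[n0 tie]|none]; last first.
    by exists 0%N => n _; apply/eqP => tie; apply: none; exists n.
  exists n0.+1 => n /subnKC <-; move: (n - n0.+1)%N => d.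
  suff : t (n0.+1 + d)%N = 0 \/ t (n0.+1 + d)%N = q by case=> ->; lia.
  elim: d => [|d IH].
    by rewrite addn0 tS tie; case: (b n0); [left|right]; lia.
  rewrite addnS tS; have := t_bound (n0.+1 + d).+1; rewrite tS.
  by case: IH => ->; case: (b _) => /=; lia.
have bE n : (N <= n)%N -> b n = (q < 2 * t n).
  move=> /no_tie ntie; have := t_bound n.+1; rewrite tS.
  by case: (b n) => /=; lia.
have [m [n [lt_mn tmn]]] : exists m n, (m < n)%N /\
    `|t (N + m)%N|%N = `|t (N + n)%N|%N.
  apply: (@nat_pigeonhole (fun n => `|t (N + n)|%N) `|q|%N) => n.
  by have := t_bound (N + n)%N; lia.
exists (N + m)%N, (n - m)%N; split; first by lia.
suff per d : t (N + m + d + (n - m))%N = t (N + m + d)%N.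
  move=> i le_i; rewrite !bE; try lia.
  by have := per (i - (N + m))%N; rewrite subnKC // => ->.
elim: d => [|d IH].
  rewrite addn0 (_ : (N + m + (n - m) = N + n)%N); last by lia.
  by have := t_bound (N + m)%N; have := t_bound (N + n)%N; lia.
by rewrite addnS addSn !tS IH !bE ?IH //; lia.
Qed.

(** The numerators over the denominator of [x] of the values of the shifted
    expansions are integers following the doubling recursion. *)
Lemma rational_eventually_periodic (R : realType) (x : rat) (b : expansion) :
  expansion_value R b = ratr x ->
  exists s r, (0 < r)%N /\ eventually_periodic b s r.
Proof.
move=> bx; pose q := denq x.
pose t := fix t n := if n is n'.+1 then 2 * t n' - q * (b n' : nat)%:Z
                     else numq x.
have q_gt0 : (0 : R) < q%:~R by rewrite ltr0z denq_gt0.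
have tE n : (t n)%:~R = q%:~R * expansion_value R (shift b n).
  elim: n => [|n IH].
    rewrite /= (_ : shift b 0 = b) // bx /ratr mulrCA divff ?mulr1 //.
    by rewrite gt_eqF.
  rewrite /= rmorphB !rmorphM /= IH (expansion_valueS R (shift b n)).
  rewrite (_ : shift (shift b n) 1 = shift b n.+1); last first.
    by apply/funext => i; rewrite /shift addnA addn1.
  by rewrite {1}/shift addn0; field.
apply: (@doubling_orbit_eventually_periodic b q t) => //.
  exact: denq_gt0.
move=> n; suff : 0 <= ((t n)%:~R : R) <= q%:~R by rewrite ler0z ler_int.
rewrite tE mulr_ge0 ?expansion_value_ge0 ?(ltW q_gt0) //=.
by rewrite ler_piMr ?expansion_value_le1 ?(ltW q_gt0).
Qed.

(** * Hausdorff measure and dimension *)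

Lemma diam_ge0 (R : realType) (U : set R) : (0 <= diam U)%E.
Proof. by apply: ereal_sup_ubound; left. Qed.

Lemma dist_le_diam (R : realType) (U : set R) (x y : R) :
  U x -> U y -> (`|x - y|%:E <= diam U)%E.
Proof. by move=> Ux Uy; apply: ereal_sup_ubound; right; exists (x, y). Qed.

Lemma diam_le (R : realType) (U : set R) (d : R) :
  0 <= d -> (forall x y, U x -> U y -> `|x - y| <= d) -> (diam U <= d%:E)%E.
Proof.
move=> d0 Ud; apply: ge_ereal_sup => _ [->|[[x y] [Ux Uy] <-]].
  by rewrite lee_fin.
by rewrite lee_fin Ud.
Qed.

Lemma diam_pow_set0 (R : realType) (t : R) : diam_pow t (@set0 R) = 0%E.
Proof. by rewrite /diam_pow; case: pselect. Qed.

Lemma diam_pow_nonempty (R : realType) (t : R) (U : set R) :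
  U !=set0 -> diam_pow t U = poweR (diam U) t.
Proof.
by move=> [x Ux]; rewrite /diam_pow; case: pselect => // U0; rewrite U0 in Ux.
Qed.

Lemma diam_pow_ge0 (R : realType) (t : R) (U : set R) : (0 <= diam_pow t U)%E.
Proof. by rewrite /diam_pow; case: pselect => [?|?] //; exact: poweR_ge0. Qed.

Lemma diam_pow_le (R : realType) (t d : R) (U : set R) :
  0 <= t -> (diam U <= d%:E)%E -> (diam_pow t U <= (d `^ t)%:E)%E.
Proof.
move=> t0 Ud; rewrite /diam_pow; case: pselect => [?|?].
  by rewrite lee_fin powR_ge0.
rewrite -poweR_EFin; apply: gt0_ler_poweR => //.
  by rewrite in_itv /= diam_ge0 leey.
by rewrite in_itv /= (le_trans (diam_ge0 _ _) Ud) leey.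
Qed.

Lemma hausdorff_premeasure_ge0 (R : realType) (s delta : R) (A : set R) :
  (0 <= hausdorff_premeasure s delta A)%E.
Proof.
apply: le_ereal_inf_tmp => _ [U _ <-].
by apply: nneseries_ge0 => i _ _; exact: diam_pow_ge0.
Qed.

Lemma hausdorff_measure_eq0 (R : realType) (t : R) (A : set R) :
  (forall delta e : R, 0 < delta -> 0 < e -> exists U : nat -> set R,
    [/\ A `<=` \bigcup_i U i, forall i, (diam (U i) <= delta%:E)%E
      & forall n, (\sum_(0 <= i < n) diam_pow t (U i) <= e%:E)%E]) ->
  hausdorff_measure t A = 0%E.
Proof.
move=> small; apply/eqP; rewrite eq_le; apply/andP; split.
  apply: ge_ereal_sup => _ [delta delta_gt0 <-].
  apply/lee_addgt0Pr => e e_gt0; rewrite add0e.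
  have [U [AU dU sumU]] := small _ _ delta_gt0 e_gt0.
  apply: (@le_trans _ _ (\sum_(0 <= i <oo) diam_pow t (U i))%E).
    by apply: ereal_inf_lbound; exists U.
  apply: lime_le; last exact: nearW.
  by apply: is_cvg_nneseries => i _ _; exact: diam_pow_ge0.
apply: le_trans (hausdorff_premeasure_ge0 _ t 1 A) _.
by apply: ereal_sup_ubound; exists 1 => /=.
Qed.

Lemma hausdorff_dim_le (R : realType) (t : R) (A : set R) :
  0 <= t -> hausdorff_measure t A = 0%E -> (hausdorff_dim A <= t%:E)%E.
Proof. by move=> t0 At; apply: ereal_inf_lbound; exists t. Qed.

(** Singletons contribute 0 to a cover in every positive exponent. *)
Lemma hausdorff_dim_countable (R : realType) (A : set R) :
  countable A -> (hausdorff_dim A <= 0)%E.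
Proof.
move=> cA; apply/lee_addgt0Pr => e e_gt0; rewrite add0e.
apply: hausdorff_dim_le; first exact: ltW.
have [A0|A0] := pselect (A = set0).
  apply: hausdorff_measure_eq0 => d a d_gt0 a_gt0; exists (fun=> set0); split.
  - by rewrite A0.
  - by move=> i; apply: diam_le => //; exact: ltW.
  - by move=> n; rewrite big1 ?lee_fin ?(ltW a_gt0) // => i _; exact: diam_pow_set0.
have /countable_injP[f] := cA; move=> f_inj.
apply: hausdorff_measure_eq0 => d a d_gt0 a_gt0.
(* The fibres of an injective enumeration have at most one point. *)
exists (fun i => [set x | A x /\ f x = i]).
have dU i : (diam [set x | A x /\ f x = i] <= 0)%E.
  apply: diam_le => // x y [Ax <-] [Ay fyx].
  by rewrite (f_inj y x) ?inE ?subrr ?normr0.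
split; first by move=> x Ax; exists (f x).
  by move=> i; apply: le_trans (dU i) _; rewrite lee_fin ltW.
move=> n; rewrite big1 ?lee_fin ?(ltW a_gt0) // => i _; apply/eqP.
rewrite eq_le diam_pow_ge0 andbT.
by apply: le_trans (diam_pow_le _ _ _ _ (ltW e_gt0) (dU i)) _; rewrite powR0 ?gt_eqF.
Qed.

(** A cover of [range f] is transported to a cover of the unit interval by
    intervals of length at most [2 * C * diam ^ t]; as Lebesgue measure is
    countably subadditive, the sums over covers are at least [(2 * C)^-1]. *)
Lemma hausdorff_measure_holder_neq0 (R : realType) (I : Type) (f g : I -> R)
    (C t : R) :
  0 < C -> 0 <= t -> `[0, 1[ `<=` range g ->
  (forall i j, `|g i - g j| <= C * `|f i - f j| `^ t) ->
  hausdorff_measure t (range f) != 0%E.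
Proof.
move=> C_gt0 t0 g_onto holder; have C2_gt0 : 0 < 2 * C by rewrite mulr_gt0.
suff lower : ((2 * C)^-1%:E <= hausdorff_premeasure t 1 (range f))%E.
  rewrite gt_eqF //; apply: (@lt_le_trans _ _ (2 * C)^-1%:E).
    by rewrite lte_fin invr_gt0.
  by apply: le_trans lower _; apply: ereal_sup_ubound; exists 1 => /=.
apply: le_ereal_inf_tmp => _ [U [fU dU] <-].
have U_fin i : diam (U i) \is a fin_num.
  rewrite ge0_fin_numE ?diam_ge0 //.
  by apply: le_lt_trans (dU i) _; rewrite ltry.
have [W [mW lW gW]] : exists W : nat -> set R,
    [/\ forall k, measurable (W k),
        forall k, (lebesgue_measure (W k) <= (2 * C)%:E * diam_pow t (U k))%E
      & forall k i, U k (f i) -> W k (g i)].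
  suff /choice[W hW] : forall k, exists W : set R, [/\ measurable W,
      (lebesgue_measure W <= (2 * C)%:E * diam_pow t (U k))%E
    & forall i, U k (f i) -> W (g i)].
    by exists W; split=> k; have [] := hW k.
  move=> k; have [[i Ui]|none] := pselect (exists i, U k (f i)); last first.
    exists set0; split=> //; last by move=> i Ui; apply: none; exists i.
    by rewrite measure0 mule_ge0 ?diam_pow_ge0 // lee_fin ltW.
  pose rho := C * fine (diam (U k)) `^ t.
  have rho0 : 0 <= rho by rewrite mulr_ge0 ?powR_ge0 ?ltW.
  exists `[g i - rho, g i + rho]%classic; split=> //.
  - rewrite lebesgue_measure_itv /= diam_pow_nonempty; last by exists (f i).
    rewrite -(fineK (U_fin k)) poweR_EFin -EFinM -mulrA -/rho.
    by case: ifP => _; rewrite -?EFinD lee_fin; lra.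
  - move=> j Uj; rewrite /= in_itv /= -ler_distl.
    apply: le_trans (holder _ _) _; rewrite ler_pM2l // ge0_ler_powR //.
      by rewrite nnegrE fine_ge0 ?diam_ge0.
    by rewrite -lee_fin fineK ?dist_le_diam.
have : (1 <= \sum_(0 <= k <oo) lebesgue_measure (W k))%E.
  rewrite (_ : 1%E = lebesgue_measure (`[0, 1[ : set R)); last first.
    by rewrite lebesgue_measure_itv /= lte_fin ltr01 -EFinD subr0.
  apply: measure_sigma_subadditive => // x /g_onto[i _ <-].
  have [k _ Uk] := fU (f i) (imageT f i).
  by exists k => //; exact: gW.
have : (\sum_(0 <= k <oo) lebesgue_measure (W k) <=
        \sum_(0 <= k <oo) (2 * C)%:E * diam_pow t (U k))%E.
  by apply: lee_nneseries => // k _; exact: measure_ge0.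
rewrite nneseriesZl => [le1 le2|k _]; last exact: diam_pow_ge0.
rewrite -(@lee_pmul2l _ (2 * C)%:E) ?lte_fin //.
by rewrite -EFinM divff ?gt_eqF //; exact: le_trans le2 le1.
Qed.

Lemma hausdorff_measure_eq0_finite (R : realType) (t : R) (A : set R) :
  0 <= t ->
  (forall delta e : R, 0 < delta -> 0 < e ->
     exists (T : finType) (V : T -> set R) (d : R),
     [/\ A `<=` \bigcup_v V v, forall v, (diam (V v) <= d%:E)%E, 0 <= d <= delta
       & #|T|%:R * d `^ t <= e]) ->
  hausdorff_measure t A = 0%E.
Proof.
move=> t0 small; apply: hausdorff_measure_eq0 => delta e delta_gt0 e_gt0.
have [T [V [d [AV dV /andP[d0 d_le] cardT]]]] := small _ _ delta_gt0 e_gt0.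
pose U i := if insub i : option 'I_#|T| is Some j then V (enum_val j) else set0.
exists U; split.
- move=> x /AV[v _ Vx]; exists (enum_rank v) => //.
  by rewrite /U valK enum_rankK.
- move=> i; rewrite /U; case: insubP => [j ? ?|?].
    by apply: le_trans (dV _) _; rewrite lee_fin.
  by apply: diam_le => //; exact: ltW.
move=> n; apply: (@le_trans _ _
    (\sum_(0 <= i < n) (if (i < #|T|)%N then d `^ t else 0)%:E)%E).
  apply: lee_sum => i _; rewrite /U; case: insubP => [j -> _|/negbTE ->].
    exact: diam_pow_le.
  by rewrite diam_pow_set0.
rewrite sumEFin lee_fin; apply: le_trans cardT.
rewrite (_ : \sum_(0 <= i < n) _ = (minn n #|T|)%:R * d `^ t); last first.
  elim: n => [|n IH]; first by rewrite big_geq // min0n mul0r.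
  rewrite big_nat_recr //= IH; case: ltnP => h.
    rewrite (minn_idPl h).
    by rewrite -(natr1 n) mulrDl mul1r.
  by rewrite (minn_idPr (leqW h)) addr0.
by rewrite ler_wpM2r ?powR_ge0 // ler_nat geq_minr.
Qed.

Lemma half_exp_powR (R : realType) (n : nat) : 2^-1 ^+ n = 2 `^ (- n%:R) :> R.
Proof. by rewrite powRN powR_mulrn // exprVn. Qed.

(** The exponent is affine in [m]; taking logarithms, the bound holds from
    [(a * ln 2 - ln e) / (c * ln 2)] on. *)
Lemma powR2_decay (R : realType) (a c e : R) : 0 < c -> 0 < e ->
  exists M : nat, forall m, (M <= m)%N -> 2 `^ (a - m%:R * c) <= e.
Proof.
move=> c_gt0 e_gt0; have ln2 : 0 < ln 2 :> R by rewrite ln_gt0 // ltr1n.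
pose B := (a * ln 2 - ln e) / (c * ln 2); exists (Num.truncn `|B|).+1 => m le_m.
have B_le : B <= m%:R.
  apply: le_trans (ler_norm _) _; apply: ltW; apply: lt_le_trans (truncnS_gt _) _.
  by rewrite ler_nat.
rewrite /powR gt_eqF // -[leRHS]lnK ?posrE // ler_expR.
by move: B_le; rewrite /B ler_pdivrMr ?mulr_gt0 //; lra.
Qed.

(** * Dimension of a local level set with balanced period *)

(** A balance point [n] ends a block, so the digits up to [n] are determined by
    the flips of the [balance_rank b n] blocks before it. *)
Lemma cover_flip_values (R : realType) (b : expansion) (n : nat) :
  deficit b n = 0 ->
  exists V : (balance_rank b n).-tuple bool -> set R,
    range (expansion_value R \o flip_blocks b) `<=` \bigcup_v V v /\
    forall v, (diam (V v) <= (2^-1 ^+ n)%:E)%E.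
Proof.
move=> n0; pose K := balance_rank b n.
exists (fun v => [set expansion_value R (flip_blocks b e) | e in
                   [set e | mkseq e K = v]]); split.
  move=> _ [e _ <-]; have sz : size (mkseq e K) == K by rewrite size_mkseq.
  by exists (Tuple sz) => //; exists e.
move=> v; apply: diam_le; first by rewrite exprn_ge0.
move=> _ _ [e ev <-] [e' e'v <-]; apply: dist_expansion_value_prefix => i lt_in.
rewrite /flip_blocks; congr (_ (+) _).
have lt_K : (balance_rank b i < K)%N by rewrite ltn_balance_rank.
by rewrite -(nth_mkseq false e lt_K) -(nth_mkseq false e' lt_K) ev e'v.
Qed.

Lemma balance_rank_period (b : expansion) (s r m : nat) :
  eventually_periodic b s r -> deficit b s = 0 -> deficit b (s + r) = 0 ->
  balance_rank b (s + m * r) = (balance_rank b s + m * balance_count b s r)%N.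
Proof.
move=> per s0 sr0; elim: m => [|m IH]; first by rewrite !mul0n !addn0.
rewrite !mulSnr !addnA balance_rankD IH; congr addn.
rewrite /balance_count (_ : (s + m * r).+1 = (m * r + s.+1)%N); last by lia.
rewrite iotaDl count_map; apply: eq_in_count => c; rewrite mem_iota => /andP[lt_sc _] /=.
by rewrite addnC (deficit_period _ _ _ _ _ per (ltnW lt_sc)) s0 sr0 subrr mulr0 addr0.
Qed.

(** After m periods the level set is covered by 2^(const + m k) sets of
    diameter 2^(-(s + m r)); the sum of their powers of exponent t decays like
    2^(-m (r t - k)). *)
Lemma hausdorff_measure_flip_eq0 (R : realType) (b : expansion) (s r : nat)
    (t : R) :
  (0 < r)%N -> eventually_periodic b s r ->
  deficit b s = 0 -> deficit b (s + r) = 0 ->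
  0 <= t -> (balance_count b s r)%:R / r%:R < t ->
  hausdorff_measure t (range (expansion_value R \o flip_blocks b)) = 0%E.
Proof.
move=> r_gt0 per s0 sr0 t0; set k := balance_count b s r => lt_t.
apply: hausdorff_measure_eq0_finite => // delta e delta_gt0 e_gt0.
have rR : 0 < r%:R :> R by rewrite ltr0n.
have rate : 0 < r%:R * t - k%:R by rewrite subr_gt0 mulrC -ltr_pdivrMr.
have [M1 decay1] := powR2_decay R (- s%:R) _ _ rR delta_gt0.
have [M2 decay2] :=
  powR2_decay R ((balance_rank b s)%:R - s%:R * t) _ _ rate e_gt0.
have [m [m_delta m_e]] : exists m : nat,
    2 `^ (- s%:R - m%:R * r%:R) <= delta /\
    2 `^ ((balance_rank b s)%:R - s%:R * t - m%:R * (r%:R * t - k%:R)) <= e.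
  by exists (M1 + M2)%N; rewrite decay1 ?leq_addr // decay2 ?leq_addl.
pose n := (s + m * r)%N; have n0 : deficit b n = 0.
  by rewrite (deficit_period _ _ _ _ _ per (leqnn s)) s0 sr0 subrr mulr0 addr0.
have [V [AV dV]] := cover_flip_values R b n n0.
exists ((balance_rank b n).-tuple bool : finType), V, (2^-1 ^+ n); split=> //.
  rewrite exprn_ge0 //= half_exp_powR.
  apply: le_trans m_delta.
  by rewrite ler_powR ?ler1n // /n natrD natrM; lra.
apply: le_trans m_e.
rewrite card_tuple card_bool half_exp_powR -powRrM natrX -powR_mulrn //.
rewrite -powRD; last by rewrite pnatr_eq0 implybT.
rewrite ler_powR ?ler1n // (balance_rank_period _ _ _ _ per) //.
by rewrite !natrD !natrM -/k; lra.
Qed.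

Lemma deficit_ones (c : expansion) (n : nat) :
  (forall i, (i < n)%N -> c i = true) -> deficit c n = - n%:Z.
Proof.
elim: n => [|n IH] ones; first by rewrite deficit0.
by rewrite deficitS IH ?ones // => [|i /ltnW]; [lia|exact: ones].
Qed.

(** Over a full period a member of the level set is balanced, hence has a zero
    digit. *)
Lemma flip_blocks_zero_digit (b : expansion) (e : nat -> bool) (s r n : nat) :
  (0 < r)%N -> eventually_periodic b s r ->
  deficit b s = 0 -> deficit b (s + r) = 0 ->
  exists j, [/\ (n < j)%N, (j < n + s + r + r)%N & flip_blocks b e j = false].
Proof.
move=> r_gt0 per s0 sr0; pose p := (s + (n %/ r).+1 * r)%N.
(* [p] is a zero of the walk at the end of a period, beyond [n]. *)
have lt_np : (n < p)%N by rewrite ltn_addl // ltn_ceil.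
have le_pn : (p <= n + s + r)%N.
  by have := leq_trunc_div n r; rewrite /p mulSn; lia.
have zeros m : deficit (flip_blocks b e) (s + m * r) = 0.
  rewrite deficit_flip_blocks (deficit_period _ _ _ _ _ per (leqnn s)).
  by rewrite s0 sr0 subrr mulr0 addr0 mulr0.
apply: contrapT => none.
have := zeros (n %/ r).+2; rewrite mulSnr addnA -/p deficit_cat zeros.
rewrite deficit_ones; first by lia.
move=> i lt_ir; apply/negbNE/negP => /negbTE zi; apply: none.
by exists (p + i)%N; split=> //; lia.
Qed.

(** The rank grows by at most 1 at each step, so it skips no value. *)
Lemma balance_rank_surj (b : expansion) (j m : nat) :
  (j <= balance_rank b m)%N ->
  exists i, balance_rank b i = j /\
            forall l, (l < i)%N -> (balance_rank b l < j)%N.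
Proof.
move=> le_j; have ex_i : exists i, (j <= balance_rank b i)%N by exists m.
case: (ex_minnP ex_i) => i le_ji min.
have lt_l l : (l < i)%N -> (balance_rank b l < j)%N.
  by rewrite !ltnNge; apply: contra => /min.
exists i; split=> //; apply/eqP; rewrite eqn_leq le_ji andbT.
case: i lt_l {le_ji min} => [//|i lt_l].
by rewrite balance_rankS; have := lt_l i (leqnn _); case: eqP => _; lia.
Qed.

(** If two sequences of flips first differ in block [j], their values are at
    most [2 ^ (- j)] apart. With [i] the first digit of block [j], the members
    they define are at least a constant times [2 ^ (- i)] apart, and [j] is at
    least [k * i / r] up to a constant. *)
Lemma flip_blocks_holder (R : realType) (b : expansion) (s r : nat) (t : R) :
  (0 < r)%N -> eventually_periodic b s r ->
  deficit b s = 0 -> deficit b (s + r) = 0 ->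
  0 <= t -> t <= (balance_count b s r)%:R / r%:R ->
  exists2 C : R, 0 < C & forall e e' : nat -> bool,
    `|expansion_value R e - expansion_value R e'| <=
    C * `|expansion_value R (flip_blocks b e) -
          expansion_value R (flip_blocks b e')| `^ t.
Proof.
move=> r_gt0 per s0 sr0 t0; set k := balance_count b s r; set d := _ / _ => le_td.
have rR : 0 < r%:R :> R by rewrite ltr0n.
have k_gt0 : (0 < k)%N.
  have := ltn_balance_rank b s (s + r) sr0.
  by rewrite balance_rankD -/k -[X in (X < _)%N]addn0 ltn_add2l => ->; lia.
(* The first term is the loss in comparing [j] with [d * i], and the second
   comes from waiting for a zero digit, at most [s + r + r] places after [i]. *)
exists (2 `^ (d * (s + r)%:R + (s + r + r)%:R * t)); first by rewrite powR_gt0.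
move=> e e'; have [<-|neq] := pselect (e = e').
  by rewrite subrr normr0 mulr_ge0 ?powR_ge0.
have ex_j : exists j, e j != e' j.
  apply: contrapT => none; apply: neq; apply/funext => j.
  by apply/eqP/negPn/negP => ne; apply: none; exists j.
case: (ex_minnP ex_j) => j ne_j min_j {ex_j neq}.
have agree l : (l < j)%N -> e l = e' l.
  by move=> lt_lj; apply/eqP; apply: contraTT lt_lj => /min_j; rewrite -leqNgt.
have le_j : (j <= balance_rank b (s + j * r))%N.
  by rewrite (balance_rank_period _ _ _ _ per) // -/k; nia.
have [i [rank_i lt_i]] := balance_rank_surj _ _ _ le_j.
have ij : (k * i <= r * j + k * (s + r))%N.
  have [le_is|lt_si] := leqP i s; first by nia.
  have := leq_balance_rank b (s + ((i - s) %/ r) * r) i.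
  rewrite (balance_rank_period _ _ _ _ per) // -/k rank_i.
  have := leq_trunc_div (i - s) r; have := ltn_ceil (i - s) r_gt0.
  by nia.
have pre l : (l < i)%N -> flip_blocks b e l = flip_blocks b e' l.
  by move=> /lt_i /agree; rewrite /flip_blocks => ->.
have gap : 2^-1 ^+ (i + s + r + r) <=
    `|expansion_value R (flip_blocks b e) -
      expansion_value R (flip_blocks b e')|.
  have half_le n : (n < i + s + r + r)%N ->
      2^-1 ^+ (i + s + r + r) <= 2^-1 ^+ n.+1 :> R.
    by move=> lt_n; rewrite ler_wiXn2l //; lra.
  have ne_i : flip_blocks b e i = ~~ flip_blocks b e' i.
    by rewrite /flip_blocks rank_i; move: ne_j; case: (e j); case: (e' j); case: (b i).
  (* The zero digit is needed in the expansion that is smaller at [i]. *)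
  case e'i : (flip_blocks b e' i) ne_i => /= ei.
    have [l [lt_il lt_l el]] := flip_blocks_zero_digit b e s r i r_gt0 per s0 sr0.
    apply: le_trans (half_le _ lt_l) _; rewrite distrC.
    apply: le_trans (ler_norm _); exact: (expansion_value_gap R _ _ i).
  have [l [lt_il lt_l el]] := flip_blocks_zero_digit b e' s r i r_gt0 per s0 sr0.
  apply: le_trans (half_le _ lt_l) _; apply: le_trans (ler_norm _).
  by apply: (expansion_value_gap R _ _ i) => // m /pre.
apply: (@le_trans _ _ (2^-1 ^+ j)).
  by rewrite distrC; exact: dist_expansion_value_prefix.
apply: (@le_trans _ _ (2 `^ (d * (s + r)%:R + (s + r + r)%:R * t) *
                       (2^-1 ^+ (i + s + r + r)) `^ t)); last first.
  by rewrite ler_wpM2l ?powR_ge0 // ge0_ler_powR // nnegrE ?exprn_ge0.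
rewrite !half_exp_powR -powRrM -powRD; last by rewrite pnatr_eq0 implybT.
rewrite ler_powR ?ler1n //.
have {}ij : d * i%:R <= j%:R + d * (s + r)%:R.
  have rd : r%:R * d = k%:R by rewrite /d mulrC divfK ?gt_eqF.
  clearbody d; rewrite -(ler_pM2l rR) mulrDr !mulrA rd.
  by rewrite -!natrM -natrD ler_nat.
have : t * i%:R <= d * i%:R by rewrite ler_wpM2r.
by rewrite -!addnA (natrD _ i); lra.
Qed.

Lemma hausdorff_dim_local_level_set (R : realType) (b : expansion)
    (a w : seq bool) :
  balanced_periodic_form b a w ->
  hausdorff_dim (expansion_value R @` local_level_set b) =
  ((balance_count b (size a) (size w))%:R / (size w)%:R)%:E.
Proof.
move=> form; have [per s0 sr0] := balanced_form_period _ _ _ form.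
have [r_gt0 _ _ _] := form.
rewrite local_level_setE image_comp.
set d := _ / _; have d0 : 0 <= d by rewrite divr_ge0.
apply/eqP; rewrite eq_le; apply/andP; split.
  apply/lee_addgt0Pr => e e_gt0; rewrite -EFinD.
  apply: hausdorff_dim_le; first by rewrite addr_ge0 // ltW.
  apply: (hausdorff_measure_flip_eq0 R b (size a) (size w)) => //.
    by rewrite addr_ge0 // ltW.
  by rewrite ltrDl.
apply: le_ereal_inf_tmp => _ [t [t0 Ht] <-]; rewrite lee_fin leNgt.
apply/negP => lt_td; move/eqP: Ht; apply/negP.
have [C C_gt0 holder] := flip_blocks_holder R b _ _ t r_gt0 per s0 sr0 t0 (ltW lt_td).
apply: (hausdorff_measure_holder_neq0 R _ _ (expansion_value R) C) => //.
move=> x; rewrite /= in_itv /= => /expansion_value_surj[e <-].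
by exists e.
Qed.

Theorem theorem3p3 (R : realType) (x : rat) (hx : 0 <= x <= 1)
    (b : expansion) (hb : expansion_value R b = ratr x) :
  [/\ (0 < hausdorff_dim (expansion_value R @` local_level_set b))%E <->
        ~ countable (local_level_set b),
      ~ countable (local_level_set b) <->
        (exists a w : seq bool, balanced_periodic_form b a w)
    & forall a w : seq bool, balanced_periodic_form b a w ->
        hausdorff_dim (expansion_value R @` local_level_set b) =
          ((balance_count b (size a) (size w))%:R / (size w)%:R)%:E].
Proof.
set A := expansion_value R @` local_level_set b.
have dim_unc : (0 < hausdorff_dim A)%E -> ~ countable (local_level_set b).
  move=> dim_gt0 cb; move: dim_gt0; rewrite ltNge => /negP; apply.
  apply: hausdorff_dim_countable.
  exact: (@sub_countable _ _ _ _ (card_image_le _ _)).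
have unc_form : ~ countable (local_level_set b) ->
    exists a w, balanced_periodic_form b a w.
  move=> unc; have [s [r [r_gt0 per]]] := rational_eventually_periodic R x b hb.
  exact: (uncountable_balanced_form b s r).
have form_dim : (exists a w, balanced_periodic_form b a w) ->
    (0 < hausdorff_dim A)%E.
  move=> [a [w form]]; rewrite (hausdorff_dim_local_level_set R b a w form).
  have [_ _ sr0] := balanced_form_period _ _ _ form.
  have [w_gt0 _ _ _] := form.
  rewrite lte_fin divr_gt0 ?ltr0n //.
  by rewrite -(ltn_add2l (balance_rank b (size a))) addn0 -balance_rankD
             ltn_balance_rank //; lia.
split; last by move=> a w; exact: hausdorff_dim_local_level_set.
- by split=> // /unc_form /form_dim.
- by split=> // /form_dim /dim_unc.
Qed.
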